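(* Let $r>0$, let $k\ge 1$ be an integer, let $a_1,\dots,a_k\in\mathbb{R}$ and $\tau_1,\dots,\tau_k\ge 0$, and put $\tau=\max_{1\le i\le k}\tau_i$. There exists an exponential solution $$x_c(t)=ce^{rt},\quad t\ge-\tau,\qquad\text{with some constant } c>0,$$ of the generalized logistic equation $$\frac{d}{dt}x(t)=r\,x(t)\left(1+\sum_{i=1}^{k}a_i\,x(t-\tau_i)\right)$$ if and only if $$\sum_{i=1}^{k}a_i e^{-r\tau_i}=0.$$
   Context: A function $x:[-\tau,\infty)\to\mathbb{R}$ is a solution of the equation if it is continuous and satisfies the equation for all $t\ge 0$ (right-hand derivative at $t=0$). *)

(* Defs.v *)
From mathcomp Require Export all_boot all_order all_algebra.
From mathcomp Require Export all_classical all_reals all_analysis.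
Export Order.TTheory GRing.Theory Num.Theory.
Export numFieldNormedType.Exports.

Set Implicit Arguments.
Unset Strict Implicit.
Unset Printing Implicit Defensive.

Local Open Scope classical_set_scope.
Local Open Scope ring_scope.

(* The neutral value 0 of the iterated maximum does not change the result
   when k >= 1 and every delay is nonnegative. *)
Definition max_delay (R : realType) (k : nat) (tau : 'I_k -> R) : R :=
  \big[Num.max/0]_(i < k) tau i.

Definition is_right_derivative (R : realType) (x : R -> R) (t l : R) : Prop :=
  h^-1 * (x (t + h) - x t) @[h --> 0^'+] --> l.

Definition logistic_rhs (R : realType) (r : R) (k : nat) (a tau : 'I_k -> R)
    (x : R -> R) (t : R) : R :=
  r * x t * (1 + \sum_(i < k) a i * x (t - tau i)).

(* A function on [-max_delay tau, +oo[ is represented by a total function;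
   when all delays are nonnegative, the predicate depends only on the values
   of x on that interval. *)
Definition is_logistic_solution (R : realType) (r : R) (k : nat)
    (a tau : 'I_k -> R) (x : R -> R) : Prop :=
  [/\ {within `[- max_delay tau, +oo[, continuous x},
      is_right_derivative x 0 (logistic_rhs r a tau x 0) &
      forall t : R, 0 < t -> is_derive t (1 : R) x (logistic_rhs r a tau x t)].

(* Main.v *)
Require Import Defs.
From mathcomp Require Import ring.

Local Open Scope classical_set_scope.
Local Open Scope ring_scope.

(** For x(t) = c e^{rt}, a delay only multiplies by a constant: x(t - tau_i) = e^{-r tau_i} x(t).
    With S the sum of the a_i e^{-r tau_i}, the right-hand side is therefore r x(t) (1 + x(t) S)
    ([logistic_rhs_exp]), whereas x' = r x. As r x never vanishes, the equation at even one time
    forces S = 0, and S = 0 gives it at all times. *)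

Lemma is_derive_expR_scaled (R : realType) (c r t : R) :
  is_derive t (1 : R) (fun s : R => c * expR (r * s)) (r * (c * expR (r * t))).
Proof.
have dl : is_derive t (1 : R) ( *%R r) r.
  by apply: is_derive_eq; rewrite scaler1.
have de := is_derive1_comp (is_derive_expR (r * t)) dl.
have := @is_deriveZ _ _ _ (expR \o *%R r) c t 1 _ de.
by rewrite /GRing.scale /= (mulrC _ r) mulrCA.
Qed.

(** The exponential is differentiable on the whole line, so the one-sided condition at 0 follows
    from the two-sided limit. *)
Lemma is_derive_right (R : realType) (x : R -> R) (t l : R) :
  is_derive t (1 : R) x l -> is_right_derivative x t l.
Proof.
move=> [dx <-]; rewrite /is_right_derivative.
apply: cvg_dnbhs_at_right.
have -> : (fun h => h^-1 * (x (t + h) - x t)) =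
    fun h => h^-1 *: ((x \o shift t) (h *: 1) - x t).
  by apply/funext => h; rewrite /GRing.scale /= mulr1 (addrC t).
exact: dx.
Qed.

Lemma logistic_rhs_exp (R : realType) (r c : R) (k : nat) (a tau : 'I_k -> R)
    (t : R) :
  logistic_rhs r a tau (fun s => c * expR (r * s)) t =
  r * (c * expR (r * t)) *
    (1 + c * expR (r * t) * \sum_(i < k) a i * expR (- r * tau i)).
Proof.
rewrite /logistic_rhs mulr_sumr; congr (_ * (1 + _)).
apply: eq_bigr => i _; rewrite mulrBr expRD mulNr; ring.
Qed.

Theorem proposition2 (R : realType) (r : R) (k : nat) (a tau : 'I_k -> R)
    (hr : 0 < r) (hk : (1 <= k)%N) (htau : forall i : 'I_k, 0 <= tau i) :
  (exists c : R, 0 < c /\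
     is_logistic_solution r a tau (fun t : R => c * expR (r * t)))
  <-> \sum_(i < k) a i * expR (- r * tau i) = 0.
Proof.
split=> [[c [c0 [_ _ sol]]] | sum0].
  (* Any positive time would do; [D1] and [D2] give two values of the same derivative. *)
  have [_ D1] := sol 1 ltr01.
  have [_ D2] := @is_derive_expR_scaled R c r 1.
  move: D1; rewrite D2 logistic_rhs_exp -[LHS]mulr1.
  have x0 : c * expR (r * 1) != 0 by rewrite mulf_neq0 ?gt_eqF ?expR_gt0.
  (* Cancelling r x(1) leaves 1 = 1 + x(1) S, with x(1) nonzero. *)
  move/(mulfI (mulf_neq0 (lt0r_neq0 hr) x0))/eqP.
  rewrite -[X in X == _]addr0 (inj_eq (addrI _)) eq_sym mulf_eq0 (negbTE x0) /=.
  by move/eqP.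
have rhsE t : logistic_rhs r a tau (fun s => 1 * expR (r * s)) t =
    r * (1 * expR (r * t)) by rewrite logistic_rhs_exp sum0 mulr0 addr0 mulr1.
(* Once S = 0 the amplitude is free, and 1 is the simplest positive choice. *)
exists 1; split; first exact: ltr01.
split=> [||t _].
- apply: continuous_subspaceT => t.
  apply: differentiable_continuous; apply/derivable1_diffP.
  by have [] := @is_derive_expR_scaled R 1 r t.
- by rewrite rhsE; apply: is_derive_right; exact: is_derive_expR_scaled.
- by rewrite rhsE; exact: is_derive_expR_scaled.
Qed.
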